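(* Let $f\colon\mathbb{N}\to\mathbb{N}$ be a growth function and let $K,d$ be positive integers. Then there exist $\varepsilon>0$ and $K'\in\mathbb{N}$ such that the following holds. For any collection $\mathcal{F}_1,\dots,\mathcal{F}_n$ of degree-$d$ factors (over a common $\mathbb{F}_2^m$) with $|\mathcal{F}_i|\le K$ for all $i$, there is a sub-collection $\mathcal{F}_{\pi(1)},\dots,\mathcal{F}_{\pi(w)}$ (distinct indices $\pi(1),\dots,\pi(w)$) of size $w\ge n^{\varepsilon}$ and degree-$d$ factors $\mathcal{G}_1,\dots,\mathcal{G}_w$ such that: (1) for every $i$, $\mathcal{G}_i$ is a refinement of $\mathcal{F}_{\pi(i)}$; (2) for every $i$, $|\mathcal{G}_i|\le K'$; (3) for every $i,j$, the factor $\mathcal{G}_i\cup\mathcal{G}_j$ is $f$-regular; (4) the factors $\mathcal{G}_1,\dots,\mathcal{G}_w$ (viewed as sets of polynomials) form a sunflower.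
   Context: A growth function is a non-decreasing $f\colon\mathbb{N}\to\mathbb{N}$ with $f(r)\ge r$ for all $r$. A degree-$d$ factor is a finite set $\mathcal{F}=\{P_1,\dots,P_K\}$ of polynomials $\mathbb{F}_2^m\to\mathbb{F}_2$ of degree at most $d$; $|\mathcal{F}|=K$ is its dimension. For $P$ not identically zero and $\ell\ge1$, $\operatorname{rank}_{\ell}(P)$ is the smallest positive integer $k$ with $P=\Gamma(Q_1,\dots,Q_k)$ for polynomials $Q_j$ of degree at most $\ell$ and some $\Gamma\colon\mathbb{F}_2^k\to\mathbb{F}_2$. A factor is $r$-regular if for every nonzero $(\lambda_1,\dots,\lambda_K)\in\mathbb{F}_2^K$, $\operatorname{rank}_{\ell-1}(\sum_i\lambda_iP_i)>r$ where $\ell=\max_i\deg(\lambda_iP_i)$; it is $f$-regular if it is $f(K)$-regular; the empty factor is regarded as regular for every parameter. $\mathcal{G}=\{Q_1,\dots,Q_{K'}\}$ refines $\mathcal{F}=\{P_1,\dots,P_K\}$ if there is $\Gamma\colon\mathbb{F}_2^{K'}\to\mathbb{F}_2^K$ with $(P_1,\dots,P_K)=\Gamma(Q_1,\dots,Q_{K'})$ as functions. A collection of (possibly repeated, possibly empty) sets $V_1,\dots,V_w$ is a sunflower if, with $C=\bigcap_iV_i$, one has $V_i\cap V_j=C$ for all $i\ne j$. *)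

(* Defs.v *)
From HB Require Import structures.
From mathcomp Require Import all_boot all_order all_algebra.
From mathcomp Require Import all_classical all_reals all_analysis.
Set Implicit Arguments. Unset Strict Implicit. Unset Printing Implicit Defensive.
Import Order.TTheory GRing.Theory Num.Theory.
Local Open Scope ring_scope.

Definition pt (m : nat) := {ffun 'I_m -> 'F_2}.
Definition bpoly (m : nat) := {ffun pt m -> 'F_2}.

Definition deg_le (m d : nat) (P : bpoly m) : bool :=
  [exists c : {ffun {set 'I_m} -> 'F_2},
     [forall S : {set 'I_m}, (d < #|S|)%N ==> (c S == 0)] &&
     [forall x : pt m, P x == \sum_(S : {set 'I_m}) c S * \prod_(i in S) x i]].

(* The degree of P: least d with deg_le d P (every P has degree <= m). *)
Definition deg (m : nat) (P : bpoly m) : nat :=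
  \big[minn/m]_(d < m.+1 | deg_le d P) (d : nat).

(* rank_l(P) > r: P is not of the form Gamma(Q_1,...,Q_k) with 1 <= k <= r
   and deg Q_j <= l  (rank = +infinity if no such representation exists). *)
Definition rank_gt (m l r : nat) (P : bpoly m) : Prop :=
  ~ exists k : nat, (0 < k <= r)%N /\
      exists (Q : 'I_k -> bpoly m) (Gamma : {ffun 'I_k -> 'F_2} -> 'F_2),
        (forall j, deg_le l (Q j)) /\
        forall x : pt m, P x = Gamma [ffun j => Q j x].

Definition degd_factor (m d : nat) (F : {set bpoly m}) : Prop :=
  forall P, P \in F -> deg_le d P.

(* r-regularity: nonzero lambda in F_2^K <-> nonempty subset S of F;
   sum_i lambda_i P_i = \sum_(P in S) P and
   l = max_i deg(lambda_i P_i) = \max_(P in S) deg P. *)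
Definition regular (m r : nat) (F : {set bpoly m}) : Prop :=
  forall S : {set bpoly m}, S \subset F -> S != finset.set0 ->
    rank_gt (\max_(P in S) deg P).-1 r (\sum_(P in S) P).

Definition f_regular (m : nat) (f : nat -> nat) (F : {set bpoly m}) : Prop :=
  regular (f #|F|) F.

Definition fvals (m : nat) (F : {set bpoly m}) (x : pt m) : {ffun 'I_#|F| -> 'F_2} :=
  [ffun i : 'I_#|F| => (nth [ffun=> 0] (enum F) i) x].

Definition refines (m : nat) (G F : {set bpoly m}) : Prop :=
  exists Gamma : {ffun 'I_#|G| -> 'F_2} -> {ffun 'I_#|F| -> 'F_2},
    forall x : pt m, fvals F x = Gamma (fvals G x).

Definition growth (f : nat -> nat) : Prop :=
  {homo f : x y / (x <= y)%N} /\ forall r, (r <= f r)%N.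

Definition sunflower (T : finType) (w : nat) (V : 'I_w -> {set T}) : Prop :=
  forall i j : 'I_w, i != j -> V i :&: V j = \bigcap_(k < w) V k.

(* Main.v *)
(* Split every factor into a common core C and a petal V_i, and assign to V_i
   its profile, the number of its polynomials of each degree.  If C is far more
   regular than the petals are numerous, then a low-rank combination in
   C u V_i, or in (C u V_i) u V_j with C u V_i already regular, has a polynomial
   of top degree in the last petal; modulo the rest, it can be traded for
   boundedly many polynomials of smaller degree.  So either w petals are
   pairwise compatible, giving the sunflower with core C, or, by pigeonhole on
   a maximal compatible family, polynomially many petals can be made smaller
   against one core C or C u V_i.  Profiles decrease lexicographically (highest
   degree first), so the recursion has a depth bounded in terms of f, K, d. *)
Require Import Defs.
From HB Require Import structures.
From mathcomp Require Import all_boot all_order all_algebra.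
From mathcomp Require Import all_classical all_reals all_analysis.
From mathcomp Require Import fintype finset zify.
Import Order.TTheory GRing.Theory Num.Theory.
Local Open Scope ring_scope.

Set Implicit Arguments. Unset Strict Implicit. Unset Printing Implicit Defensive.

(** * The degree of a polynomial over the two-element field *)

Section Degree.
Variable m : nat.
Implicit Types (P Q : bpoly m) (d e l : nat).

Lemma deg_leW d e P : (d <= e)%N -> deg_le d P -> deg_le e P.
Proof.
move=> de /existsP[c /andP[/forallP h1 h2]]; apply/existsP; exists c.
rewrite h2 andbT; apply/forallP => S; apply/implyP => eS.
by have := h1 S; rewrite (leq_ltn_trans de eS).
Qed.

Lemma deg_le_deg d P : deg_le d P -> deg_le (deg P) P.
Proof.
move=> dP; rewrite /deg; elim/big_ind: _ => //.
  (* The default value [m] of the minimum is a valid degree bound: no set of variables has more than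
     [m] elements. *)
  case/existsP: dP => c /andP[_ h2]; apply/existsP; exists c.
  rewrite h2 andbT; apply/forallP => S; apply/implyP.
  by rewrite ltnNge -[X in (_ <= X)%N](card_ord m) max_card.
by move=> x y dx dy; rewrite /minn; case: ifP.
Qed.

Lemma deg_min l P : deg_le l P -> (deg P <= l)%N.
Proof.
move=> lP; rewrite /deg.
have degm (r : seq 'I_m.+1) : (\big[minn/m]_(e <- r | deg_le e P) e <= m)%N.
  elim: r => [|e r ih]; rewrite (big_nil, big_cons) //.
  by case: ifP => // _; rewrite geq_min ih orbT.
have [lm|ml] := ltnP l m.+1; last exact: leq_trans (degm _) (ltnW ml).
have: Ordinal lm \in index_enum 'I_m.+1 by rewrite mem_index_enum.
elim: (index_enum _) => // e r ih; rewrite inE big_cons => /orP[/eqP<-|/ih ler].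
  by rewrite /= lP geq_min leqnn.
by case: ifP => // _; rewrite geq_min ler orbT.
Qed.

Lemma deg_le0_const P x y : deg_le 0 P -> P x = P y.
Proof.
case/existsP=> c /andP[/forallP c0 /forallP Pc].
rewrite (eqP (Pc x)) (eqP (Pc y)); apply: eq_bigr => S _.
have [->|S0] := eqVneq S set0; first by rewrite !big_set0.
by have := c0 S; rewrite card_gt0 S0 => /eqP->; rewrite !mul0r.
Qed.

End Degree.

(** * Functional dependence, regularity and the trading of polynomials *)

Section Determination.
Variable m : nat.
Implicit Types (P Q : bpoly m) (A B D S F G V : {set bpoly m}).

(** Being a function of the polynomials in [A], stated through fibres so that neither an ordering of
    [A] nor the function itself has to be carried along. *)
Definition determines A P :=
  forall x y : pt m, {in A, forall Q, Q x = Q y} -> P x = P y.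

Lemma determines_mem A P : P \in A -> determines A P.
Proof. by move=> PA x y; apply. Qed.

Lemma determines_trans A B P :
  {in A, forall Q, determines B Q} -> determines A P -> determines B P.
Proof. by move=> AB AP x y Bxy; apply: AP => Q /AB; apply. Qed.

Lemma determinesS A B P : A \subset B -> determines A P -> determines B P.
Proof.
by move=> /subsetP AB; apply: determines_trans => Q /AB; exact: determines_mem.
Qed.

Lemma determines_sum A S :
  {in S, forall P, determines A P} -> determines A (\sum_(P in S) P).
Proof.
by move=> AS x y Axy; rewrite !sum_ffunE; apply: eq_bigr => P /AS; apply.
Qed.

Lemma determinesB A P Q :
  determines A P -> determines A Q -> determines A (P - Q).
Proof. by move=> AP AQ x y Axy; rewrite !ffunE (AP x y) // (AQ x y). Qed.

Lemma fvals_determine F x y :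
  fvals F x = fvals F y <-> {in F, forall P, P x = P y}.
Proof.
split=> [Fxy P PF|Fxy].
  have iF : (index P (enum F) < #|F|)%N by rewrite cardE index_mem mem_enum.
  move/ffunP: Fxy => /(_ (Ordinal iF)); rewrite !ffunE /=.
  by rewrite nth_index // mem_enum.
apply/ffunP => i; rewrite !ffunE; apply: Fxy.
by rewrite -mem_enum mem_nth // -cardE.
Qed.

Lemma refinesP G F : {in F, forall P, determines G P} -> refines G F.
Proof.
(* On a value attained by [G] any preimage serves, because [F] is constant on the fibres of [G]; on
   other values 0 is arbitrary. *)
move=> GF; exists (fun v => if [pick x | fvals G x == v] is Some x
  then fvals F x else 0) => x.
case: pickP => [y /eqP Gyx|/(_ x)]; last by rewrite eqxx.
by apply/fvals_determine => P PF; apply: GF => //; apply/fvals_determine.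
Qed.

(* The rank condition freed of the map Gamma: a low rank means being
   determined by a small set of polynomials of low degree. *)
Definition strongly_regular r F := forall S A, S \subset F -> S != set0 ->
  (#|A| <= r)%N -> {in A, forall Q, deg_le (\max_(P in S) deg P).-1 Q} ->
  ~ determines A (\sum_(P in S) P).

Lemma strongly_regular_regular r F : strongly_regular r F -> regular r F.
Proof.
move=> rF S SF S0 [k [/andP[_ kr] [Q [Gamma [Qdeg QS]]]]].
apply: (rF S [set Q j | j : 'I_k]) => //.
- by apply: leq_trans kr; rewrite -[X in (_ <= X)%N]card_ord leq_imset_card.
- by move=> _ /imsetP[j _ ->].
move=> x y Qxy; rewrite !QS; congr Gamma; apply/ffunP => j; rewrite !ffunE.
by apply: Qxy; apply: imset_f.
Qed.

Lemma strongly_regularW r r' F :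
  (r <= r')%N -> strongly_regular r' F -> strongly_regular r F.
Proof. by move=> rr' rF S A SF S0 Ar; apply: rF => //; apply: leq_trans rr'. Qed.

Lemma strongly_regular0 r : strongly_regular r set0.
Proof. by move=> S A; rewrite subset0 => ->. Qed.

Definition reducible r D V := exists P A, [/\ P \in V, (#|A| <= r)%N,
  {in A, forall Q, (0 < deg P)%N && deg_le (deg P).-1 Q} &
  determines (D :|: (V :\ P) :|: A) P].

(* If the degree of a low-rank combination were attained only in D, then the
   few terms in V, of smaller degree, could be moved to the other side. *)
Lemma irregular_reducible d r s D V : degd_factor d (D :|: V) ->
  (#|V| <= s)%N -> strongly_regular (r + s) D ->
  ~ strongly_regular r (D :|: V) -> reducible r D V.
Proof.
move=> dDV Vs rD irr; apply: contrapT => nred; apply: irr => S A SDV S0 Ar Adeg AS.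
set l := \max_(P in S) deg P in Adeg.
have degS P : P \in S -> (deg P <= l)%N by move=> PS; apply: leq_bigmax_cond.
have [Pm PmS Pml] : exists2 P, P \in S & deg P = l.
  have S_gt0 : (0 < #|S|)%N by rewrite card_gt0.
  by have [P PS e] := eq_bigmax_cond (@deg m) S_gt0; exists P.
have dle P : P \in S -> deg_le (deg P) P.
  by move=> /(subsetP SDV) /dDV; apply: deg_le_deg.
(* A [P] of top degree in [V] is the whole sum minus the other terms, so it would make [V]
   reducible. If [l] is 0, [P] is constant and the empty set takes the place of [A]. *)
have topD P : P \in S -> deg P = l -> P \in D.
  move=> PS Pl; have := subsetP SDV _ PS; rewrite !inE => /orP[//|PV].
  case: nred; exists P, (if l == 0%N then set0 else A); split => //.
  - by case: ifP; rewrite ?cards0.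
  - rewrite Pl; case: ifP => [_ Q|l0 Q /Adeg ->]; first by rewrite inE.
    by rewrite lt0n l0.
  case: (eqVneq l 0%N) => [l0|l0].
    by move=> x y _; apply: deg_le0_const; rewrite -l0 -Pl; apply: dle.
  have PE : \sum_(Q in S) Q - \sum_(Q in S :\ P) Q = P.
    by rewrite (big_setD1 P PS) /= addrK.
  rewrite -[X in determines _ X]PE.
  apply: determinesB; first exact: determinesS (subsetUr _ _) AS.
  apply: determines_sum => Q; rewrite in_setD1 => /andP[QP QS].
  apply: determines_mem; have := subsetP SDV _ QS.
  by rewrite !inE QP => /orP[->|->]; rewrite ?orbT.
have sSD : S :&: D \subset S by exact: subsetIl.
have SDl : \max_(P in S :&: D) deg P = l.
  apply/eqP; rewrite eqn_leq; apply/andP; split.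
    by apply/bigmax_leqP => P; rewrite inE => /andP[/degS].
  by rewrite -Pml; apply: leq_bigmax_cond; rewrite inE PmS topD.
(* The part of the sum in [D] keeps the top degree [l], yet it is determined by [A] and the at most
   [s] terms outside [D], all of degree below [l]. This is where the surplus [s] in the regularity
   of [D] is spent. *)
apply: (rD (S :&: D) (A :|: (S :\: D))); rewrite ?subsetIr ?SDl //.
- by apply/set0Pn; exists Pm; rewrite inE PmS topD.
- apply: leq_trans (leq_card_setU _ _) _; apply: leq_add => //.
  apply: leq_trans Vs; apply: subset_leq_card; apply/subsetP => P.
  by rewrite inE => /andP[PD /(subsetP SDV)]; rewrite inE (negbTE PD).
- move=> Q; rewrite inE => /orP[/Adeg //|]; rewrite inE => /andP[QD QS].
  apply: deg_leW (dle _ QS); have := degS _ QS; rewrite leq_eqVlt.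
  by case/orP => [/eqP/(topD _ QS) QD'|]; [rewrite QD' in QD | lia].
have -> : \sum_(P in S :&: D) P = \sum_(P in S) P - \sum_(P in S :\: D) P.
  by rewrite [in RHS](big_setID D (A := S)) /= addrK.
apply: determinesB; first exact: determinesS (subsetUl _ _) AS.
by apply: determines_sum => P PSD; apply: determines_mem; rewrite inE PSD orbT.
Qed.

Definition profile_le (b : nat -> nat) V :=
  forall l, (#|[set P in V | deg P == l]| <= b l)%N.

Lemma profile_le_card d b V : degd_factor d V -> profile_le b V ->
  (#|V| <= \sum_(l < d.+1) b l)%N.
Proof.
move=> dV bV; rewrite -sum1_card.
rewrite (partition_big (fun P => inord (deg P) : 'I_d.+1) xpredT) //=.
apply: leq_sum => l _; apply: leq_trans (bV l).
rewrite sum1_card; apply: subset_leq_card; apply/subsetP => P.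
rewrite !inE /in_mem /= => /andP[PV /eqP<-]; rewrite PV inordK ?eqxx //.
by rewrite ltnS; apply: deg_min; apply: dV.
Qed.

Lemma card_profile_le V s : (#|V| <= s)%N -> profile_le (fun=> s) V.
Proof.
move=> Vs l; apply: leq_trans Vs; apply: subset_leq_card.
by apply/subsetP => P; rewrite inE => /andP[].
Qed.

(** The bound left after one polynomial of degree [l] is traded for at most [r] of smaller
    degree. *)
Definition drop_profile r l (b : nat -> nat) e :=
  if (e < l)%N then (b e + r)%N else if e == l then (b e).-1 else b e.

(** The new petal has [A] in place of [P]. No information is lost, because [P] is still a function
    of [D] and the new petal. *)
Lemma reducible_profile d b r D V :
  degd_factor d V -> profile_le b V -> reducible r D V ->
  exists l V', [/\ (l <= d)%N, (0 < b l)%N, degd_factor d V',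
    profile_le (drop_profile r l b) V' &
    {in D :|: V, forall P, determines (D :|: V') P}].
Proof.
move=> dV bV [P [A [PV Ar Adeg DP]]].
have Pd : (deg P <= d)%N by apply: deg_min; apply: dV.
exists (deg P), (V :\ P :|: A); split => //.
- apply: leq_trans (bV (deg P)); rewrite card_gt0; apply/set0Pn; exists P.
  by rewrite inE PV eqxx.
- move=> Q; rewrite !inE => /orP[/andP[_ /dV]//|/Adeg/andP[_]].
  by apply: deg_leW; apply: leq_trans (leq_pred _) Pd.
- move=> e; rewrite /drop_profile.
  have degA Q : Q \in A -> (deg Q < deg P)%N.
    by case/Adeg/andP => P0 /deg_min; lia.
  case: ltnP => eP.
    apply: leq_trans (leq_add (bV e) Ar).
    apply: leq_trans (leq_card_setU _ _); apply: subset_leq_card.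
    apply/subsetP => Q; rewrite !inE.
    by case/andP=> [/orP[/andP[_ ->]|->] ->]; rewrite ?orbT.
  (* From the degree of [P] upwards [A] contributes nothing, and at the degree of [P] itself the
     removal of [P] lowers the count. *)
  have sub : [set Q in V :\ P :|: A | deg Q == e]
      \subset [set Q in V | deg Q == e] :\ P.
    apply/subsetP => Q; rewrite !inE => /andP[/orP[/andP[-> ->]->//|]].
    by move=> /degA QP /eqP Qe; move: eP QP; rewrite -Qe; lia.
  apply: leq_trans (subset_leq_card sub) _.
  have := bV e; rewrite (cardsD1 P) inE PV /= [e == _]eq_sym.
  case: eqP => _; last by rewrite add0n.
  by rewrite add1n => h; rewrite -ltnS prednK // (leq_ltn_trans _ h).
move=> Q QDV; have [->|QP] := eqVneq Q P; first by rewrite setUA.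
by apply: determines_mem; move: QDV; rewrite !inE QP => /orP[->|->]; rewrite ?orbT.
Qed.

End Determination.

(** * Lexicographic descent of profiles *)

Definition lex_lt d (b' b : nat -> nat) := exists l, [/\ (l < d)%N,
  (b' l < b l)%N & forall e, (l < e < d)%N -> b' e = b e].

Lemma wf_lex_lt d : well_founded (lex_lt d).
Proof.
elim: d => [b|d ih b]; first by constructor => b' [l []].
(* Here [n] bounds the leading entry [b d]. A drop there is handled by induction on [n], whatever
   happens below; a drop elsewhere leaves [b d] fixed and is handled by accessibility in the order
   on the lower entries. *)
move: {2}(b d).+1 (ltnSn (b d)) => n.
elim: n b => [b|n ihn b bn]; first by rewrite ltn0.
move: b (ih b) bn; apply: Acc_ind => b _ ihb bn.
constructor => b' [l [ld bl be]].
have [dl|dl] := eqVneq l d.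
  by apply: ihn; rewrite dl in bl; lia.
have bd : b' d = b d by apply: be; rewrite ltnS leqnn; lia.
apply: ihb; last by rewrite bd.
by exists l; split=> [||e he]; [lia | | apply: be; lia].
Qed.

Lemma drop_profile_lt d r l b : (l <= d)%N -> (0 < b l)%N ->
  lex_lt d.+1 (drop_profile r l b) b.
Proof.
move=> ld bl; exists l; split => //; rewrite /drop_profile.
  by rewrite ltnn eqxx; lia.
by move=> e he; case: ltnP => [|_]; [lia|]; case: eqP; lia.
Qed.

(** * Pigeonhole and subsets of prescribed size *)

Lemma pigeonhole (I T : finType) (h : I -> T) (J : {set I}) (X : {set T}) k :
  {in J, forall j, h j \in X} -> (#|X| * k < #|J|)%N ->
  exists2 t, t \in X & (k < #|[set j in J | h j == t]|)%N.
Proof.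
move=> hX kJ; apply: contrapT => nt.
suff : (#|J| <= #|X| * k)%N by rewrite leqNgt kJ.
rewrite -sum1_card (partition_big h (mem X)) //= -sum_nat_const.
apply: leq_sum => t tX; rewrite sum1_card leqNgt; apply/negP => kt.
apply: nt; exists t => //; apply: leq_trans kt _; apply: subset_leq_card.
by apply/subsetP => j; rewrite !inE.
Qed.

Lemma exists_subset_card (T : finType) (A : {set T}) k :
  (k <= #|A|)%N -> exists2 B : {set T}, B \subset A & #|B| = k.
Proof.
move=> kA; exists [set x in take k (enum A)].
  by apply/subsetP => x; rewrite inE => /mem_take; rewrite mem_enum.
by rewrite cardsE (card_uniqP (take_uniq _ (enum_uniq _))) size_takel -?cardE.
Qed.

(** * The recursion on the profiles of core and petals *)

Lemma uniform_bounds (Q : nat -> nat -> nat -> Prop) N :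
  (forall l B B' K K', (B <= B')%N -> (K <= K')%N -> Q l B K -> Q l B' K') ->
  (forall l, (l < N)%N -> exists B K, Q l B K) ->
  exists B K, forall l, (l < N)%N -> Q l B K.
Proof.
move=> Qmono; elim: N => [|N ih] QN; first by exists 0%N, 0%N.
have [B1 [K1 Q1]] : exists B K, forall l, (l < N)%N -> Q l B K.
  by apply: ih => l lN; apply: QN; apply: ltnW.
have [B2 [K2 Q2]] := QN N (ltnSn N).
exists (maxn B1 B2), (maxn K1 K2) => l; rewrite ltnS leq_eqVlt.
case/orP => [/eqP->|lN]; [apply: Qmono Q2|apply: Qmono (Q1 _ lN)];
  by rewrite ?leq_maxl ?leq_maxr.
Qed.

(* [X], the core of the sunflower found, contains the given core [C] only up to
   refinement. *)
Definition sunflower_bound (f : nat -> nat) d (b c : nat -> nat) B K :=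
  forall m n w (J : {set 'I_n}) (C : {set bpoly m}) (V : 'I_n -> {set bpoly m}),
  (1 < w)%N -> (w ^ B <= #|J|)%N -> degd_factor d C -> profile_le c C ->
  {in J, forall i, degd_factor d (V i) /\ profile_le b (V i)} ->
  exists (W : {set 'I_n}) (X : {set bpoly m}) (G : 'I_n -> {set bpoly m}),
  [/\ W \subset J, #|W| = w,
    {in W, forall i, [/\ degd_factor d (G i), (#|G i| <= K)%N &
      {in C :|: V i, forall P, determines (G i) P}]},
    {in W &, forall i j,
      strongly_regular (f #|G i :|: G j|) (G i :|: G j)} &
    {in W &, forall i j, i != j -> G i :&: G j = X}].

Lemma sunflower_boundW f d b c B B' K K' : (B <= B')%N -> (K <= K')%N ->
  sunflower_bound f d b c B K -> sunflower_bound f d b c B' K'.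
Proof.
move=> BB' KK' H m n w J C V w1 wJ dC cC VJ.
have [|W [X [G [WJ Ww GW Greg GX]]]] := H m n w J C V w1 _ dC cC VJ.
  by apply: leq_trans wJ; rewrite leq_exp2l.
exists W, X, G; split=> // i /GW[dG GK Gdet]; split=> //.
exact: leq_trans KK'.
Qed.

Lemma degd_factorU m d (F G : {set bpoly m}) :
  degd_factor d F -> degd_factor d G -> degd_factor d (F :|: G).
Proof. by move=> dF dG P; rewrite inE => /orP[/dF|/dG]. Qed.

(** Petals clash in two ways. A polynomial shared outside [C] already lies in [C :|: U], so it
    leaves [V] without replacement; otherwise the union is irregular and [irregular_reducible]
    applies with [C :|: U] as core. *)
Lemma clash_reducible m d r s (C U V : {set bpoly m}) :
  degd_factor d C -> degd_factor d U -> degd_factor d V -> (#|V| <= s)%N ->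
  strongly_regular (r + s) (C :|: U) ->
  ~ (U :&: V \subset C /\ strongly_regular r (C :|: U :|: V)) ->
  reducible r (C :|: U) V.
Proof.
move=> dC dU dV Vs rCU clash.
have [UV|/subsetPn[P]] := boolP (U :&: V \subset C); last first.
  rewrite inE => /andP[PU PV] PC; exists P, set0; split => //.
  - by rewrite cards0.
  - by move=> Q; rewrite inE.
  - by apply: determines_mem; rewrite !inE PU orbT.
apply: (@irregular_reducible m d r s) => //.
  by do 2?[apply: degd_factorU].
by move=> h; apply: clash.
Qed.

(** The case of a regular core. Adding a petal, of size at most [t], costs [t] in regularity, whence
    the levels [r + t + t] for the core, [r + t] with one petal and [r] with two. The bound on [r]
    is what [f] asks of a core with two petals. *)
Lemma sunflower_step f d (b : nat -> nat) B1 K1 (t := (\sum_(l < d.+1) b l)%N)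
  m n w s r
  (J : {set 'I_n}) (C : {set bpoly m}) (V : 'I_n -> {set bpoly m}) :
  {homo f : x y / (x <= y)%N} ->
  (f (s + t + t) <= r)%N ->
  (forall l, (l < d.+1)%N -> (0 < b l)%N ->
    sunflower_bound f d (drop_profile (r + t) l b) (fun=> s + t)%N B1 K1) ->
  (1 < w)%N -> (w ^ (B1 + d + 3) <= #|J|)%N ->
  degd_factor d C -> (#|C| <= s)%N -> strongly_regular (r + t + t) C ->
  {in J, forall i, degd_factor d (V i) /\ profile_le b (V i)} ->
  exists (W : {set 'I_n}) (X : {set bpoly m}) (G : 'I_n -> {set bpoly m}),
  [/\ W \subset J, #|W| = w,
    {in W, forall i, [/\ degd_factor d (G i), (#|G i| <= maxn K1 (s + t))%N &
      {in C :|: V i, forall P, determines (G i) P}]},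
    {in W &, forall i j,
      strongly_regular (f #|G i :|: G j|) (G i :|: G j)} &
    {in W &, forall i j, i != j -> G i :&: G j = X}].
Proof.
move=> fmono fr H1 w1 wJ dC Cs Creg VJ.
have Vt i : i \in J -> (#|V i| <= t)%N.
  by case/VJ => dV bV; apply: profile_le_card.
have CVst i : i \in J -> (#|C :|: V i| <= s + t)%N.
  by move=> iJ; rewrite (leq_trans (leq_card_setU _ _)) // leq_add // Vt.
have dCV i : i \in J -> degd_factor d (C :|: V i).
  by move=> /VJ[dV _]; apply: degd_factorU.
pose good i := `[< strongly_regular (r + t) (C :|: V i) >].
pose compat i j :=
  `[< V i :&: V j \subset C /\ strongly_regular r (C :|: V i :|: V j) >].
have compatC i j : compat i j = compat j i.
  by rewrite /compat [V i :&: _]setIC setUAC.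
pose indep (W : {set 'I_n}) := [&& W \subset J, [forall i in W, good i] &
  [forall i in W, forall j in W, (i != j) ==> compat i j]].
have indep0 : indep set0.
  by apply/and3P; split; [exact: sub0set | |]; apply/forall_inP => i; rewrite inE.
(* A maximal family of good, pairwise compatible petals: with [w] members it is the sunflower; if
   smaller, every other index fails against [C] alone or against a member. *)
have [W /maxsetP[/and3P[WJ /forall_inP Wgood /forall_inP Wcompat] Wmax] _] :=
  maxset_exists indep0.
have [wW|Ww] := leqP w #|W|.
  have [W' W'W W'w] := exists_subset_card wW.
  exists W', C, (fun i => C :|: V i).
  have W'J i : i \in W' -> i \in J by move/(subsetP W'W)/(subsetP WJ).
  split=> //; first exact: fintype.subset_trans WJ.
  - move=> i iW'; split; first exact/dCV/W'J.
      by rewrite leq_max CVst ?orbT // W'J.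
    by move=> P; exact: determines_mem.
  - move=> i j iW' jW'; have [<-|ij] := eqVneq i j.
      rewrite setUid; have /asboolP := Wgood _ (subsetP W'W _ iW').
      apply: strongly_regularW; apply: (leq_trans _ (leq_addr _ _)).
      apply: leq_trans fr; apply: fmono.
      by rewrite (leq_trans (CVst _ (W'J _ iW'))) ?leq_addr.
    have /forall_inP/(_ _ (subsetP W'W _ jW')) := Wcompat _ (subsetP W'W _ iW').
    rewrite ij => /asboolP[_].
    have -> : C :|: V i :|: (C :|: V j) = C :|: V i :|: V j.
      by rewrite setUACA setUid setUA.
    apply: strongly_regularW; apply: leq_trans fr; apply: fmono.
    rewrite (leq_trans (leq_card_setU _ _)) // leq_add ?Vt ?CVst //; exact: W'J.
  - move=> i j iW' jW' ij.
    have /forall_inP/(_ _ (subsetP W'W _ jW')) := Wcompat _ (subsetP W'W _ iW').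
    rewrite ij => /asboolP[VC _].
    by rewrite -setUIr; apply/setUidPl.
pose core (o : option 'I_n) := if o is Some i then C :|: V i else C.
pose X := setX (None |: [set Some i | i in W]) [set: 'I_d.+1].
(* Here [y] records the core over which petal [j] is reduced ([None] for [C] itself), the degree at
   which its profile drops, and the reduced petal. *)
pose ok j (y : (option 'I_n * 'I_d.+1) * {set bpoly m}) :=
  [/\ y.1 \in X, (0 < b y.1.2)%N, degd_factor d y.2,
    profile_le (drop_profile (r + t) y.1.2 b) y.2 &
    {in core y.1.1 :|: V j, forall P, determines (core y.1.1 :|: y.2) P}].
have X_card : (#|X| <= w * d.+1)%N.
  rewrite cardsX cardsT card_ord leq_mul2r; apply/orP; right.
  rewrite cardsU1 (leq_trans _ Ww) // -add1n leq_add ?leq_b1 //.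
  exact: leq_imset_card.
have okP j : exists y, j \in J :\: W -> ok j y.
  have [jJW|] := boolP (j \in J :\: W); last by exists ((None, ord0), set0).
  have /setDP[jJ jW] := jJW; have [dVj bVj] := VJ _ jJ.
  have [q qW red] : exists2 q, q \in None |: [set Some i | i in W] &
      reducible (r + t) (core q) (V j).
    have [jgood|/asboolP jbad] := boolP (good j); last first.
      exists None; first by rewrite !inE eqxx.
      exact: (irregular_reducible (dCV _ jJ) (Vt _ jJ)).
    have [i iW ij] : exists2 i, i \in W & ~~ compat i j.
      apply/exists_inP; apply: contraT; rewrite negb_exists_in.
      move=> /forall_inP Wj.
      have {Wj}Wj i : i \in W -> compat i j by move=> /Wj; rewrite negbK.
      suff /Wmax/(_ (subsetUr _ _)) e : indep (j |: W).
        by rewrite -e setU11 in jW.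
      apply/and3P; split.
      - by rewrite subUset sub1set jJ.
      - by apply/forall_inP => i; rewrite !inE => /orP[/eqP->|/Wgood].
      - apply/forall_inP => i; rewrite !inE => /orP[/eqP->|iW];
          apply/forall_inP => k; rewrite !inE => /orP[/eqP->|kW];
          apply/implyP => // ik.
        + by rewrite eqxx in ik.
        + by rewrite compatC Wj.
        + exact: Wj.
        + by have /forall_inP/(_ _ kW) := Wcompat _ iW; rewrite ik.
    have iJ := subsetP WJ _ iW.
    exists (Some i); first by rewrite !inE imset_f.
    have [dVi _] := VJ _ iJ.
    have [P [A [PV Ar Adeg DP]]] : reducible r (C :|: V i) (V j).
      apply: (@clash_reducible m d r t) => //; first exact: Vt.
        by have /asboolP := Wgood _ iW.
      by move/asboolP: ij.
    (* Weakened from [r] to [r + t], so that both kinds of reduction obey the same profile bound. *)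
    by exists P, A; split => //; apply: leq_trans Ar (leq_addr _ _).
  have [l [V' [ld bl dV' bV' V'det]]] := reducible_profile dVj bVj red.
  exists ((q, Ordinal (ld : l < d.+1)%N), V') => _; split => //=.
  by rewrite !inE andbT; rewrite !inE in qW.
have [y {okP}okP] := boolp.choice okP.
(* In the exponent [B1 + d + 3], the recursive call takes [B1], the choice of degree [d + 1], the
   choice of core 1, and the last 1 absorbs the removal of [W] and the strict inequality. *)
have JW : (#|X| * w ^ B1 < #|J :\: W|)%N.
  have wB1 : (0 < w ^ B1)%N by rewrite expn_gt0 (ltn_trans _ w1).
  have wd : (d.+1 < w ^ d.+1)%N by apply: ltn_expl.
  have e : (w ^ (B1 + d + 3) = w ^ B1 * w ^ d.+1 * w * w)%N.
    have -> : (B1 + d + 3 = B1 + d.+1 + 1 + 1)%N by lia.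
    by rewrite !expnD expn1.
  have JWE : (#|J :\: W| = #|J| - #|W|)%N by rewrite cardsD (setIidPr WJ).
  rewrite e in wJ; move: wB1 wd wJ X_card Ww w1; rewrite JWE.
  move: (w ^ B1)%N (w ^ d.+1)%N #|J| #|X| #|W| => u v j x p u0 dv uvj xw pw w1.
  have h1 : (x * u <= w * d.+1 * u)%N by rewrite leq_mul2r xw orbT.
  have h2 : (u * (d.+2) * w * 2 <= u * v * w * w)%N.
    by rewrite !leq_mul.
  nia.
have [[q l] qlX /ltnW wJ'] := pigeonhole (h := fun j => (y j).1)
  (fun j jJW => let: And5 h _ _ _ _ := okP j jJW in h) JW.
set J' := [set _ in _ | _] in wJ'.
have J'P j : j \in J' -> j \in J :\: W /\ (y j).1 = (q, l).
  by rewrite inE => /andP[-> /eqP].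
have [j0 j0J'] : exists j, j \in J'.
  apply/set0Pn; rewrite -card_gt0 (leq_trans _ wJ') // expn_gt0.
  by rewrite (ltn_trans _ w1).
have bl : (0 < b l)%N.
  by have [/okP[_ + _ _ _] e] := J'P _ j0J'; rewrite e.
have qJ i : q = Some i -> i \in J.
  move=> qi; apply: (subsetP WJ); move: qlX; rewrite qi !inE andbT /=.
  by case/imsetP => k kW [->].
have dcore : degd_factor d (core q).
  by case: (q) qJ => //= i /(_ _ erefl); apply: dCV.
have core_card : profile_le (fun=> s + t)%N (core q).
  apply: card_profile_le; case: (q) qJ => //= [i /(_ _ erefl)|_].
    exact: CVst.
  exact: leq_trans Cs (leq_addr _ _).
have C_core : C \subset core q by case: (q) => //= i; apply: subsetUl.
have [|W' [X' [G [W'J' W'w GW' Greg GX]]]] :=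
    H1 l (ltn_ord l) bl m n w J' (core q) (fun j => (y j).2) w1 wJ' dcore core_card.
  by move=> j /J'P[/okP[_ _ dV' bV' _] e]; split=> //; rewrite e in bV'.
have J'J : J' \subset J by apply/subsetP => j /J'P[/setDP[]].
exists W', X', G; split=> //; first exact: fintype.subset_trans J'J.
move=> i iW'; have [dG GK Gdet] := GW' i iW'; split=> //.
  by rewrite leq_max GK.
have [/okP[_ _ _ _ Vdet] e] := J'P _ (subsetP W'J' _ iW').
move=> P PCV; apply: (determines_trans Gdet); rewrite e in Vdet.
by apply: Vdet; move: PCV; rewrite !inE => /orP[/(subsetP C_core)->|->]; rewrite ?orbT.
Qed.

(** Nested descent, on [b] outside and on [c] inside. Reducing petals may enlarge the core, so the
    outer hypothesis covers all core profiles; an irregular core is reduced with the petals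
    untouched. *)
Lemma sunflower_bound_exists f d b c : {homo f : x y / (x <= y)%N} ->
  exists B K, sunflower_bound f d b c B K.
Proof.
move=> fmono; move: b (wf_lex_lt d.+1 b) c; apply: Acc_ind => b _ ihb c.
move: c (wf_lex_lt d.+1 c); apply: Acc_ind => c _ ihc.
pose t := (\sum_(l < d.+1) b l)%N; pose s := (\sum_(l < d.+1) c l)%N.
pose r := f (s + t + t)%N.
have [B1 [K1 H1]] : exists B K, forall l, (l < d.+1)%N -> (0 < b l)%N ->
    sunflower_bound f d (drop_profile (r + t) l b) (fun=> s + t)%N B K.
  apply: uniform_bounds => [l B B' K K' BB' KK' H bl|l ld].
    exact: sunflower_boundW (H bl).
  have [bl|bl] := posnP (b l); first by exists 0%N, 0%N.
  have [|B [K H]] := ihb (drop_profile (r + t) l b) _ (fun=> s + t)%N.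
    exact: drop_profile_lt.
  by exists B, K.
have [B2 [K2 H2]] : exists B K, forall l, (l < d.+1)%N -> (0 < c l)%N ->
    sunflower_bound f d b (drop_profile (r + t + t) l c) B K.
  apply: uniform_bounds => [l B B' K K' BB' KK' H cl|l ld].
    exact: sunflower_boundW (H cl).
  have [cl|cl] := posnP (c l); first by exists 0%N, 0%N.
  have [|B [K H]] := ihc (drop_profile (r + t + t) l c).
    exact: drop_profile_lt.
  by exists B, K.
exists (maxn (B1 + d + 3) B2), (maxn (maxn K1 (s + t)) K2).
move=> m n w J C V w1 wJ dC cC VJ.
have Cs : (#|C| <= s)%N by apply: profile_le_card.
have w0 : (0 < w)%N by apply: ltn_trans w1.
have [Creg|Cirr] := EM (strongly_regular (r + t + t) C).
  have [|W [X [G [WJ Ww GW Greg GX]]]] :=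
      sunflower_step fmono (leqnn _) H1 w1 _ dC Cs Creg VJ.
    by apply: leq_trans wJ; rewrite leq_pexp2l // leq_maxl.
  exists W, X, G; split=> // i /GW[dG GK Gdet]; split=> //.
  by rewrite leq_max GK.
have dC0 : degd_factor d (set0 :|: C) by rewrite set0U.
(* The core is itself treated as a petal, over the empty core, which is regular for every
   parameter. *)
have Cred : reducible (r + t + t) set0 C.
  apply: (irregular_reducible dC0 Cs (@strongly_regular0 m _)).
  by rewrite set0U.
have [l [C' [ld cl dC' cC' C'det]]] := reducible_profile dC cC Cred.
have [|W [X [G [WJ Ww GW Greg GX]]]] := H2 l ld cl m n w J C' V w1 _ dC' cC' VJ.
  by apply: leq_trans wJ; rewrite leq_pexp2l // leq_maxr.
exists W, X, G; split=> // i /GW[dG GK Gdet]; split=> //.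
  by rewrite leq_max GK orbT.
move=> P; rewrite inE => /orP[PC|PV]; last by apply: Gdet; rewrite inE PV orbT.
have : determines (set0 :|: C') P by apply: C'det; rewrite set0U.
by rewrite set0U; apply: determines_trans => Q QC'; apply: Gdet; rewrite inE QC'.
Qed.

(** * From the recursion to the theorem *)

Lemma sunflower_core (T : finType) w (V : 'I_w -> {set T}) (X : {set T}) :
  (forall i j, i != j -> V i :&: V j = X) -> sunflower V.
Proof.
move=> VX i j ij; apply/eqP; rewrite finset.eqEsubset; apply/andP; split.
  apply/bigcapsP => k _; rewrite (VX _ _ ij); have [->|ki] := eqVneq k i.
    by rewrite -(VX _ _ ij) finset.subsetIl.
  by rewrite -(VX _ _ ki) finset.subsetIl.
by rewrite finset.subsetI !finset.bigcap_inf.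
Qed.

Lemma card_bigcup_le (T : finType) n (F : 'I_n -> {set T}) K :
  (forall i, #|F i| <= K)%N -> (#|\bigcup_i F i| <= n * K)%N.
Proof.
move=> FK; rewrite -[n in (n * K)%N]card_ord -sum_nat_const.
elim/big_ind2: _ => [|A a A' a' Aa Aa'|i _]; rewrite ?cards0 //.
by apply: leq_trans (leq_card_setU _ _) _; apply: leq_add.
Qed.

Lemma profile_le0 m (b : nat -> nat) : profile_le b (set0 : {set bpoly m}).
Proof.
move=> l; rewrite (_ : [set _ in _ | _] = set0) ?cards0 //.
by apply/setP => P; rewrite !inE.
Qed.

(** The recursion is run with [F] as core and empty petals; regularity of a pair with equal indices
    is that of a single factor. *)
Lemma exists_regular_refinement f d N : {homo f : x y / (x <= y)%N} ->
  exists K, forall m (F : {set bpoly m}), degd_factor d F -> (#|F| <= N)%N ->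
  exists G : {set bpoly m}, [/\ degd_factor d G, (#|G| <= K)%N,
    {in F, forall P, determines G P} & strongly_regular (f #|G|) G].
Proof.
move=> fmono.
have [B [K H]] := sunflower_bound_exists d (fun=> 0%N) (fun=> N) fmono.
exists K => m F dF FN.
have [|||W [X [G [_ W2 GW Greg _]]]] :=
    H m (2 ^ B)%N 2 [set: _] F (fun=> set0) (ltnSn 1) _ dF.
- by rewrite cardsT card_ord.
- exact: card_profile_le.
- by move=> i _; split; [move=> P; rewrite inE | exact: profile_le0].
have [i iW] : exists i, i \in W by apply/set0Pn; rewrite -card_gt0 W2.
have [dG GK Gdet] := GW i iW; exists (G i); split=> //.
  by move=> P PF; apply: Gdet; rewrite inE PF.
by have := Greg i i iW iW; rewrite setUid.
Qed.

Lemma powR_root_le (R : realType) (n w e : nat) : (0 < e)%N ->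
  (n <= w ^ e)%N -> (n%:R : R) `^ (e%:R)^-1 <= w%:R.
Proof.
move=> e0 nwe; have e_neq0 : e%:R != 0 :> R by rewrite pnatr_eq0 -lt0n.
have -> : w%:R = (w ^ e)%N%:R `^ (e%:R)^-1 :> R.
  by rewrite natrX -powR_mulrn ?ler0n // -powRrM divff // powRr1 ?ler0n.
by rewrite ge0_ler_powR ?nnegrE ?ler0n ?invr_ge0 ?ler_nat.
Qed.

Theorem theorem5p2 (R : realType) (f : nat -> nat) (K d : nat) :
  growth f -> (0 < K)%N -> (0 < d)%N ->
  exists (eps : R) (K' : nat), 0 < eps /\
    forall (m n : nat) (F : 'I_n -> {set bpoly m}),
      (forall i, degd_factor d (F i)) ->
      (forall i, (#|F i| <= K)%N) ->
      exists (w : nat) (pi : 'I_w -> 'I_n) (G : 'I_w -> {set bpoly m}),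
        [/\ injective pi,
            (n%:R `^ eps <= w%:R) &
            (forall i, degd_factor d (G i))] /\
        [/\ (forall i, refines (G i) (F (pi i))),
            (forall i, (#|G i| <= K')%N),
            (forall i j, f_regular f (G i :|: G j)) &
            sunflower G].
Proof.
move=> [fmono _] _ _.
have [B0 [K1 H1]] := sunflower_bound_exists d (fun=> K) (fun=> 0%N) fmono.
(* The successor makes the exponent positive, so that [w] is at most [w ^ B] and the root is
   defined. *)
pose B := B0.+1.
have [K2 H2] := exists_regular_refinement d (2 ^ B * K) fmono.
exists ((2 * B)%N%:R^-1), (maxn K1 K2); split; first by rewrite invr_gt0 ltr0n.
move=> m n F dF FK.
(* For small [n] all indices are kept, with one regular refinement of the union of all factors
   repeated [n] times: a sunflower without petals. *)
have [nB|nB] := ltnP n (2 ^ B)%N.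
  have dUF : degd_factor d (\bigcup_i F i).
    by move=> P /bigcupP[i _]; exact: dF.
  have UFK : (#|\bigcup_i F i| <= 2 ^ B * K)%N.
    by apply: leq_trans (card_bigcup_le FK) _; rewrite leq_mul2r ltnW ?orbT.
  have [G [dG GK Gdet Greg]] := H2 m _ dUF UFK.
  exists n, id, (fun=> G); split; split=> //.
  - apply: powR_root_le => //; case: (n) => // k.
    by rewrite -[X in (X <= _)%N]expn1 leq_pexp2l.
  - move=> i; apply: refinesP => P PF; apply: Gdet.
    by apply/bigcupP; exists i.
  - by move=> i; rewrite leq_max GK orbT.
  - by move=> i j; rewrite setUid; apply: strongly_regular_regular.
  - by apply: (@sunflower_core _ _ _ G) => i j _; rewrite setIid.
have ub w : (w ^ B <= n)%N -> (w <= n)%N.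
  by apply: leq_trans; case: w => // w; rewrite -[X in (X <= _)%N]expn1 leq_pexp2l.
have ex : exists w, (w ^ B <= n)%N by exists 2%N.
(* By maximality [n] is below [w.+1 ^ B], and [w.+1] is at most [w ^ 2] since [w] is at least 2.
   Hence [n] is at most [w ^ (2 * B)], which explains the choice of [eps]. *)
case: (ex_maxnP ex ub) => w wn wmax.
have w2 : (1 < w)%N by apply: wmax.
have [||||W [X [G [_ Ww GW Greg GX]]]] :=
    H1 m n w [set: _] set0 F w2.
- rewrite cardsT card_ord; apply: leq_trans wn.
  by rewrite leq_pexp2l // ltnW.
- by move=> P; rewrite inE.
- exact: profile_le0.
- by move=> i _; split; [exact: dF | apply: card_profile_le].
exists #|W|, enum_val, (G \o enum_val); split; split.
- exact: enum_val_inj.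
- rewrite Ww; apply: powR_root_le => //; rewrite expnM.
  have : (n < w.+1 ^ B)%N.
    by rewrite ltnNge; apply/negP => /wmax; rewrite ltnn.
  move/ltnW/leq_trans; apply; rewrite leq_exp2r //.
  by rewrite expnS expn1; nia.
- by move=> i; have [] := GW _ (enum_valP i).
- move=> i; have [_ _ Gdet] := GW _ (enum_valP i).
  by apply: refinesP => P PF; apply: Gdet; rewrite inE PF orbT.
- move=> i; have [_ GK _] := GW _ (enum_valP i).
  by rewrite leq_max GK.
- move=> i j; apply: strongly_regular_regular.
  exact: Greg (enum_valP i) (enum_valP j).
apply: (@sunflower_core _ _ _ X) => i j ij.
by apply: GX; rewrite ?enum_valP // (inj_eq enum_val_inj).
Qed.
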